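(* Given a string $T$ of length $n$ and a string attractor $\Gamma$ of size $\gamma$ for $T$, one can build a bidirectional parse (and therefore a macro scheme) for $T$ of size $\mathcal{O}(\gamma\log(n/\gamma))$.
   Context: A string attractor of $T$ is a set $\Gamma\subseteq\{1,\dots,n\}$ such that every substring $T[i..j]$ has an occurrence $T[i'..j']=T[i..j]$ with $p\in[i',j']$ for some $p\in\Gamma$. A macro scheme of size $b$ for $T$ is a set of $b$ directives, each of the form $T[i..j]\leftarrow T[i'..j']$ (copy) or $T[i]\leftarrow c$ (assign character $c$), such that $T$ can be unambiguously decoded from the directives (every position is resolved by a finite chain of copies ending in an assignment). A bidirectional parse is a macro scheme whose left-hand sides form a factorization of $T$ (they cover all of $T$ and do not overlap); its size is its number of directives (phrases).
   Formalization: The logarithm log(n/γ) is read as max(1, log₂(n/γ)), since the literal bound fails when γ is close to n: for n distinct characters γ = n gives log(n/γ) = 0, yet n phrases are needed. *)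

(* Defs.v *)
From HB Require Import structures.
From mathcomp Require Import all_boot all_order all_algebra.
From mathcomp Require Import reals exp.

Set Implicit Arguments.
Unset Strict Implicit.
Unset Printing Implicit Defensive.

(* Positions of a string of length n are the ordinals 'I_n, i.e. the usual
   positions 1, ..., n shifted down by one. *)

(* T[i..j], both ends included. *)
Definition substring (A : Type) (n : nat) (T : n.-tuple A) (i j : 'I_n) : seq A :=
  take (j.+1 - i) (drop i T).

Definition string_attractor (A : Type) (n : nat) (T : n.-tuple A)
    (Gamma : {set 'I_n}) : Prop :=
  forall i j : 'I_n, i <= j ->
  exists i' j' : 'I_n,
    [/\ i' <= j',
        substring T i' j' = substring T i j
      & exists2 p, p \in Gamma & i' <= p <= j'].

(* [Copy i j i' j'] is T[i..j] <- T[i'..j'], and [Assign i c] is T[i] <- c. *)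
Inductive directive (A : Type) (n : nat) : Type :=
| Copy of 'I_n & 'I_n & 'I_n & 'I_n
| Assign of 'I_n & A.
Arguments Copy {A n}.
Arguments Assign {A n}.

Section DirectiveEqType.
Variables (A : eqType) (n : nat).

Definition directive_code (d : directive A n) :
    'I_n * 'I_n * ('I_n * 'I_n) + 'I_n * A :=
  match d with
  | Copy i j i' j' => inl (i, j, (i', j'))
  | Assign i c => inr (i, c)
  end.

Definition directive_decode (s : 'I_n * 'I_n * ('I_n * 'I_n) + 'I_n * A) :
    directive A n :=
  match s with
  | inl (i, j, (i', j')) => Copy i j i' j'
  | inr (i, c) => Assign i c
  end.

Lemma directive_codeK : cancel directive_code directive_decode.
Proof. by case. Qed.

HB.instance Definition _ :=
  Equality.copy (directive A n) (can_type directive_codeK).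
End DirectiveEqType.

Definition wf_directive (A : Type) (n : nat) (d : directive A n) : bool :=
  match d with
  | Copy i j i' j' => [&& i <= j, i' <= j' & j - i == j' - i']
  | Assign _ _ => true
  end.

Definition in_lhs (A : Type) (n : nat) (d : directive A n) (p : 'I_n) : bool :=
  match d with
  | Copy i j _ _ => i <= p <= j
  | Assign i _ => p == i
  end.

(* [resolves D p c]: a finite chain of copies of D starting at position p ends
   in an assignment of the character c. The equation [q + i = p + i'] says that
   q is at the same offset in T[i'..j'] as p is in T[i..j]. *)
Inductive resolves (A : eqType) (n : nat) (D : seq (directive A n)) :
    'I_n -> A -> Prop :=
| resolves_assign p c : Assign p c \in D -> resolves D p c
| resolves_copy (i j i' j' p q : 'I_n) c :
    Copy i j i' j' \in D -> i <= p <= j -> q + i = p + i' ->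
    resolves D q c -> resolves D p c.

(* The equivalence expresses unambiguous decodability: every position is
   resolved, and only to the character of T at that position. The size of the
   macro scheme is [size D], D being duplicate-free. *)
Definition macro_scheme (A : eqType) (n : nat) (T : n.-tuple A)
    (D : seq (directive A n)) : Prop :=
  [/\ uniq D,
      all (@wf_directive A n) D
    & forall p c, resolves D p c <-> c = tnth T p].

Definition lhs_factorization (A : eqType) (n : nat)
    (D : seq (directive A n)) : Prop :=
  (forall p : 'I_n, exists2 d, d \in D & in_lhs d p) /\
  (forall d1 d2, d1 \in D -> d2 \in D -> d1 != d2 ->
     forall p : 'I_n, ~~ (in_lhs d1 p && in_lhs d2 p)).

Definition bidirectional_parse (A : eqType) (n : nat) (T : n.-tuple A)
    (D : seq (directive A n)) : Prop :=
  macro_scheme T D /\ lhs_factorization D.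

(* Logarithm truncated below at 1, as is implicit in bounds of the form
   O(g log(n/g)): when n/g is close to 1, log(n/g) is close to 0, whereas a
   string with g distinct characters needs at least g directives. *)
Definition log2_ge1 (R : realType) (x : R) : R :=
  Num.max 1%R (ln x / ln 2%:R)%R.

(* Main.v *)
Require Import Defs.
From mathcomp Require Import all_boot all_order all_algebra.
From mathcomp Require Import reals exp.
From mathcomp Require Import zify lra.

Set Implicit Arguments.
Unset Strict Implicit.
Unset Printing Implicit Defensive.
Import Order.TTheory GRing.Theory Num.Theory.

(** Cut [T] at every position at distance [2 ^ k] from the attractor, for
    [2 ^ k] up to about [n / #|Gamma|], and at the multiples of the last of
    these powers.  A phrase that is not a single attractor position is then
    no longer than its distance to [Gamma].  Copying it from an occurrence that
    crosses [Gamma] brings every position strictly closer to [Gamma], so that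
    chains of copies end at attractor positions, which are the assigned ones. *)

Section Substrings.
Variables (A : Type) (n : nat) (T : n.-tuple A).

Lemma size_substring (i j : 'I_n) : size (substring T i j) = j.+1 - i.
Proof. by rewrite size_takel // size_drop size_tuple leq_sub2r. Qed.

Lemma eq_substring_length (i j i' j' : 'I_n) :
  substring T i' j' = substring T i j -> j'.+1 - i' = j.+1 - i.
Proof. by move=> /(congr1 size); rewrite !size_substring. Qed.

Lemma eq_substring_tnth (i j i' j' p q : 'I_n) :
  substring T i' j' = substring T i j -> i <= p <= j -> q + i = p + i' ->
  tnth T q = tnth T p.
Proof.
move=> eq_ij p_in q_at; have x0 := tnth T p.
have len_ij := eq_substring_length eq_ij.
have := congr1 (fun s => nth x0 s (p - i)) eq_ij.
rewrite /substring !nth_take ?nth_drop; try lia.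
rewrite !(tnth_nth x0).
have -> : i + (p - i) = p by lia.
by have -> : i' + (p - i) = q by lia.
Qed.

Lemma attractor_card_gt0 (Gamma : {set 'I_n}) :
  string_attractor T Gamma -> 0 < n -> 0 < #|Gamma|.
Proof.
move=> attT n_gt0; pose o := Ordinal n_gt0.
have [_ [_ [_ _ [a aG _]]]] := attT o o (leqnn o).
by apply/card_gt0P; exists a.
Qed.

End Substrings.

Section DescendingSchemes.
Variables (A : eqType) (n : nat) (T : n.-tuple A).
Implicit Types (d : directive A n) (D : seq (directive A n)).

Definition sound_directive d : Prop :=
  match d with
  | Copy i j i' j' => substring T i' j' = substring T i j
  | Assign i c => c = tnth T i
  end.

Lemma resolves_sound D p c :
  (forall d, d \in D -> sound_directive d) -> resolves D p c -> c = tnth T p.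
Proof.
move=> soundD; elim=> {p c} [p c|i j i' j' p q c] /soundD //=.
by move=> eq_ij p_in q_at _ ->; apply: eq_substring_tnth eq_ij p_in q_at.
Qed.

Variable mu : 'I_n -> nat.

Definition lowering_directive d : Prop :=
  match d with
  | Copy i j i' j' =>
      forall p q : 'I_n, i <= p <= j -> q + i = p + i' -> mu q < mu p
  | Assign _ _ => True
  end.

Definition descending_directive d : Prop :=
  [/\ wf_directive d, sound_directive d & lowering_directive d].

Lemma descending_resolves D p :
  (forall d, d \in D -> descending_directive d) ->
  (forall q, exists2 d, d \in D & in_lhs d q) -> resolves D p (tnth T p).
Proof.
move=> descD coverD; have [m] := ubnP (mu p); elim: m p => // m IHm p mu_p.
have [d dD] := coverD p; case: d dD => [i j i' j'|i c] dD /=; last first.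
  move/eqP=> ->; have [_ /= <- _] := descD _ dD.
  exact: resolves_assign.
move=> p_in; have [/= /and3P[le_ij le_ij' /eqP len] eq_ij lower] := descD _ dD.
have q_lt : i' + (p - i) < n by have := ltn_ord j'; lia.
pose q := Ordinal q_lt.
have q_at : q + i = p + i' by rewrite /q /=; lia.
apply: (resolves_copy dD p_in q_at).
rewrite -(eq_substring_tnth eq_ij p_in q_at).
by apply: IHm; have := lower p q p_in q_at; lia.
Qed.

Lemma macro_scheme_of_descending D :
  uniq D -> (forall d, d \in D -> descending_directive d) ->
  (forall p, exists2 d, d \in D & in_lhs d p) -> macro_scheme T D.
Proof.
move=> uniqD descD coverD; split=> // [|p c].
  by apply/allP => d /descD[].
split=> [|->]; last exact: descending_resolves.
by apply: resolves_sound => d /descD[].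
Qed.

End DescendingSchemes.

Section Blocks.
Variables (n : nat) (B : {set 'I_n}).
Implicit Types s e p : 'I_n.

Definition uncut s e : bool := [forall b in B, ~~ (s < b <= e)].

Lemma uncutxx s : uncut s s.
Proof. by apply/forall_inP => b _; lia. Qed.

Definition block_end s : 'I_n :=
  [arg max_(e > s | (s <= e) && uncut s e) (e : nat)].

Lemma block_end_spec s :
  [/\ s <= block_end s, uncut s (block_end s)
    & forall e, s <= e -> uncut s e -> e <= block_end s].
Proof.
rewrite /block_end; case: arg_maxnP => [|e /andP[le_se cut_e] max_e].
  by rewrite leqnn uncutxx.
by split=> // p le_sp cut_p; apply: max_e; rewrite le_sp.
Qed.

Lemma in_block s p : (s <= p <= block_end s) = (s <= p) && uncut s p.
Proof.
have [_ /forall_inP uncut_end max_end] := block_end_spec s.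
case: leqP => //= le_sp; apply/idP/idP => [le_pe|]; last exact: max_end.
by apply/forall_inP => b /uncut_end; lia.
Qed.

Lemma block_inj s1 s2 p : s1 \in B -> s2 \in B ->
  s1 <= p <= block_end s1 -> s2 <= p <= block_end s2 -> s1 = s2.
Proof.
move=> s1B s2B; rewrite !in_block.
move=> /andP[le1 /forall_inP/(_ _ s2B) cut1].
move=> /andP[le2 /forall_inP/(_ _ s1B) cut2].
by apply: ord_inj; lia.
Qed.

Hypothesis B_0 : forall p, p = 0 :> nat -> p \in B.

Lemma block_cover p : exists2 s, s \in B & s <= p <= block_end s.
Proof.
pose o := Ordinal (leq_ltn_trans (leq0n p) (ltn_ord p)).
pose cut_before := [pred b in B | b <= p].
have o_cut : cut_before o by rewrite /= B_0.
have [s /andP[sB le_sp] max_s] := arg_maxnP (@nat_of_ord n) o_cut.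
exists s => //; rewrite in_block le_sp; apply/forall_inP => b bB.
apply/negP => /andP[lt_sb le_bp].
have b_cut : cut_before b by rewrite /= bB.
by have := max_s b b_cut; lia.
Qed.

Variables (A : eqType) (phrase : 'I_n -> directive A n).
Hypothesis lhs_phrase :
  forall s p, in_lhs (phrase s) p = (s <= p <= block_end s).

Let phrases := [seq phrase s | s <- enum B].

Lemma phrases_uniq : uniq phrases.
Proof.
rewrite map_inj_in_uniq ?enum_uniq // => s1 s2.
rewrite !mem_enum => s1B s2B eq12.
have s1_in : s1 <= s1 <= block_end s1 by rewrite in_block leqnn uncutxx.
by apply: (block_inj s1B s2B s1_in); rewrite -lhs_phrase -eq12 lhs_phrase.
Qed.

Lemma phrases_factorization : lhs_factorization phrases.
Proof.
split=> [p|_ _ /mapP[s1 s1B ->] /mapP[s2 s2B ->] neq12 p].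
  have [s sB p_in] := block_cover p.
  by exists (phrase s); rewrite ?lhs_phrase // map_f // mem_enum.
rewrite !mem_enum in s1B s2B; rewrite !lhs_phrase.
by apply/negP => /andP[p1 p2]; rewrite (block_inj s1B s2B p1 p2) eqxx in neq12.
Qed.

End Blocks.

Section GradedCuts.
Variables (n : nat) (Gamma : {set 'I_n}).

(* The default [n] exceeds every distance between two positions. *)
Definition dist_to (p : 'I_n) : nat :=
  \big[Order.min/n]_(a in Gamma) `|p - a|%N.

Lemma dist_to_le (p a : 'I_n) : a \in Gamma -> dist_to p <= `|p - a|%N.
Proof. by move=> aG; rewrite -leEnat bigmin_le_cond. Qed.

Lemma lt_dist_to (l : nat) (p : 'I_n) :
  l < n -> {in Gamma, forall a : 'I_n, l < `|p - a|%N} -> l < dist_to p.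
Proof. by move=> *; rewrite -leEnat le_bigmin. Qed.

Definition graded (B : {set 'I_n}) : Prop :=
  forall s e : 'I_n, s <= e -> uncut B s e ->
  (s = e /\ s \in Gamma) \/
  (forall p : 'I_n, s <= p <= e -> e - s < dist_to p).

Variables (A : eqType) (T : n.-tuple A).
Hypothesis attT : string_attractor T Gamma.

Lemma exists_descending_phrase (B : {set 'I_n}) (s e : 'I_n) :
  graded B -> s <= e -> uncut B s e ->
  exists2 d, descending_directive T dist_to d &
    forall p, in_lhs d p = (s <= p <= e).
Proof.
move=> gradedB le_se uncut_se.
have [[<- sG]|far] := gradedB s e le_se uncut_se.
  exists (Assign s (tnth T s)) => // p.
  by rewrite /= -(inj_eq val_inj) eqn_leq andbC.
have [i' [j' [le_ij' eq_ij [a aG a_in]]]] := attT le_se.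
have len := eq_substring_length eq_ij.
exists (Copy s e i' j') => //; split=> //=; first by rewrite le_se le_ij'; lia.
by move=> p q p_in q_at; have := far p p_in; have := dist_to_le q aG; lia.
Qed.

Lemma graded_parse (B : {set 'I_n}) :
  (forall p : 'I_n, p = 0 :> nat -> p \in B) -> graded B ->
  exists2 D : seq (directive A n), bidirectional_parse T D & size D = #|B|.
Proof.
move=> B_0 gradedB.
have phrase_ex (s : 'I_n) : exists d, descending_directive T dist_to d /\
    forall p, in_lhs d p = (s <= p <= block_end B s).
  have [le_se uncut_se _] := block_end_spec B s.
  by have [d] := exists_descending_phrase gradedB le_se uncut_se; exists d.
have [phrase phraseP] := fin_all_exists phrase_ex.
have lhs_phrase s := (phraseP s).2.
exists [seq phrase s | s <- enum B]; last by rewrite size_map cardE.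
have factD := phrases_factorization B_0 lhs_phrase.
split=> //; apply: macro_scheme_of_descending factD.1.
  exact: phrases_uniq lhs_phrase.
by move=> _ /mapP[s _ ->]; apply: (phraseP s).1.
Qed.

End GradedCuts.

Lemma ltn_of_no_pow2_between (K l d : nat) : 0 < d -> l < 2 ^ K ->
  (forall k, k <= K -> ~~ (d < 2 ^ k <= d + l)) -> l < d.
Proof.
move=> d_gt0 l_lt no_pow.
have /andP[le_d lt_d] := trunc_log_bounds (isT : 1 < 2) d_gt0.
have [le_K|lt_K] := leqP K (trunc_log 2 d).
  by have := leq_pexp2l (isT : 0 < 2) le_K; lia.
by have := no_pow _ lt_K; rewrite expnS in lt_d *; lia.
Qed.

Section DyadicCuts.
Variables (n : nat) (Gamma : {set 'I_n}) (K : nat).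

(* In the third line the subtraction may truncate to 0, a cut anyway. *)
Definition dyadic_marks : seq nat :=
  [seq 2 ^ K * i | i <- iota 0 #|Gamma|] ++
  [seq a + 2 ^ k | a : 'I_n <- enum Gamma, k <- iota 0 K.+1] ++
  [seq a.+1 - 2 ^ k | a : 'I_n <- enum Gamma, k <- iota 0 K.+1].

Definition dyadic_cuts : {set 'I_n} := [set p in pmap insub dyadic_marks].

Lemma card_dyadic_cuts : #|dyadic_cuts| <= #|Gamma| * (2 * K + 3).
Proof.
rewrite cardsE (leq_trans (card_size _)) // size_pmap.
rewrite (leq_trans (count_size _ _)) //.
rewrite !size_cat size_map !size_allpairs !size_iota -!cardE.
by set g := #|Gamma|; lia.
Qed.

Lemma right_dyadic_cut (a p : 'I_n) k :
  a \in Gamma -> k <= K -> p = a + 2 ^ k :> nat -> p \in dyadic_cuts.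
Proof.
move=> aG le_kK p_at; rewrite inE mem_pmap_sub /= !mem_cat p_at.
by apply/or3P/Or32/allpairsP; exists (a, k); rewrite mem_enum mem_iota.
Qed.

Lemma left_dyadic_cut (a p : 'I_n) k :
  a \in Gamma -> k <= K -> p = a.+1 - 2 ^ k :> nat -> p \in dyadic_cuts.
Proof.
move=> aG le_kK p_at; rewrite inE mem_pmap_sub /= !mem_cat p_at.
by apply/or3P/Or33/allpairsP; exists (a, k); rewrite mem_enum mem_iota.
Qed.

Hypothesis n_le : n <= #|Gamma| * 2 ^ K.

Lemma multiple_dyadic_cut (p : 'I_n) : 2 ^ K %| p -> p \in dyadic_cuts.
Proof.
move=> /dvdnP[i p_eq]; rewrite inE mem_pmap_sub /= mem_cat p_eq mulnC map_f //.
rewrite mem_iota /= add0n -(@ltn_pmul2r (2 ^ K)) ?expn_gt0 // -p_eq.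
exact: leq_trans n_le.
Qed.

Lemma uncut_dyadic_length (s e : 'I_n) :
  s <= e -> uncut dyadic_cuts s e -> e - s < 2 ^ K.
Proof.
move=> le_se /forall_inP uncut_se; rewrite ltnNge; apply/negP => long.
have lt_sm : s < (s %/ 2 ^ K).+1 * 2 ^ K by rewrite ltn_ceil ?expn_gt0.
have le_me : (s %/ 2 ^ K).+1 * 2 ^ K <= e.
  by have := leq_divM s (2 ^ K); rewrite mulSn; lia.
pose m := Ordinal (leq_ltn_trans le_me (ltn_ord e)).
have mB : m \in dyadic_cuts by rewrite multiple_dyadic_cut //= dvdn_mull.
by have := uncut_se m mB; rewrite /= lt_sm le_me.
Qed.

Lemma uncut_dyadic_right (s e a : 'I_n) : s <= e ->
  uncut dyadic_cuts s e -> a \in Gamma -> a < s -> e - s < s - a.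
Proof.
move=> le_se uncut_se aG lt_as.
apply: (@ltn_of_no_pow2_between K); rewrite ?subn_gt0 ?uncut_dyadic_length //.
move=> k le_kK; apply/negP => between.
have lt_n : a + 2 ^ k < n by have := ltn_ord e; lia.
pose p := Ordinal lt_n.
have /(forall_inP uncut_se) := right_dyadic_cut (p := p) aG le_kK erefl.
by rewrite /=; lia.
Qed.

Lemma uncut_dyadic_left (s e a : 'I_n) : s <= e ->
  uncut dyadic_cuts s e -> a \in Gamma -> e < a -> e - s < a - e.
Proof.
move=> le_se uncut_se aG lt_ea.
apply: (@ltn_of_no_pow2_between K); rewrite ?subn_gt0 ?uncut_dyadic_length //.
move=> k le_kK; apply/negP => between.
have lt_n : a.+1 - 2 ^ k < n by have := ltn_ord e; lia.
pose p := Ordinal lt_n.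
have /(forall_inP uncut_se) := left_dyadic_cut (p := p) aG le_kK erefl.
by rewrite /=; lia.
Qed.

Lemma uncut_dyadic_attractor (s e a : 'I_n) :
  uncut dyadic_cuts s e -> a \in Gamma -> s <= a <= e -> s = a /\ e = a.
Proof.
move=> /forall_inP uncut_se aG a_in.
have aB : a \in dyadic_cuts.
  by apply: (left_dyadic_cut aG (leq0n K)); rewrite subn1.
have := uncut_se a aB; have [lt_ae|le_ea] := ltnP a e; last first.
  by move=> le_as; split; apply: ord_inj; lia.
have lt_n : a + 2 ^ 0 < n by have := ltn_ord e; rewrite expn0; lia.
pose p := Ordinal lt_n.
have /uncut_se := right_dyadic_cut (p := p) aG (leq0n K) erefl.
by rewrite /= expn0; lia.
Qed.

Lemma graded_dyadic_cuts : graded Gamma dyadic_cuts.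
Proof.
move=> s e le_se uncut_se.
have [/andP[/eqP eq_se sG]|not_singleton] := boolP ((s == e) && (s \in Gamma)).
  by left.
right=> p p_in; apply: lt_dist_to => [|a aG]; first by have := ltn_ord e; lia.
have [lt_as|le_sa] := ltnP a s.
  by have := uncut_dyadic_right le_se uncut_se aG lt_as; lia.
have [lt_ea|le_ae] := ltnP e a.
  by have := uncut_dyadic_left le_se uncut_se aG lt_ea; lia.
have a_in : s <= a <= e by rewrite le_sa le_ae.
have [sa ea] := uncut_dyadic_attractor uncut_se aG a_in.
by rewrite sa ea eqxx aG in not_singleton.
Qed.

End DyadicCuts.

Lemma attractor_parse (A : eqType) (n : nat) (T : n.-tuple A)
    (Gamma : {set 'I_n}) (K : nat) :
  string_attractor T Gamma -> n <= #|Gamma| * 2 ^ K ->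
  exists2 D : seq (directive A n), bidirectional_parse T D &
    size D <= #|Gamma| * (2 * K + 3).
Proof.
move=> attT n_le.
have cut_0 (p : 'I_n) : p = 0 :> nat -> p \in dyadic_cuts Gamma K.
  by move=> p0; rewrite multiple_dyadic_cut // p0 dvdn0.
have [D parseD sizeD] := graded_parse attT cut_0 (graded_dyadic_cuts n_le).
by exists D; rewrite // sizeD card_dyadic_cuts.
Qed.

Lemma attractor_parse_trunc_log (A : eqType) (n : nat) (T : n.-tuple A)
    (Gamma : {set 'I_n}) :
  string_attractor T Gamma ->
  exists2 D : seq (directive A n), bidirectional_parse T D &
    size D <= #|Gamma| * (2 * trunc_log 2 (n %/ #|Gamma|) + 5).
Proof.
move=> attT; set K := trunc_log 2 _.
have -> : 2 * K + 5 = 2 * K.+1 + 3 by lia.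
apply: attractor_parse => //.
have [n0|n_gt0] := posnP n; first by rewrite [leqLHS]n0.
have G_gt0 := attractor_card_gt0 attT n_gt0.
by rewrite mulnC ltnW // -ltn_divLR // trunc_log_ltn.
Qed.

Local Open Scope ring_scope.

Lemma natr_divn_le (R : numFieldType) (m d : nat) :
  (m %/ d)%:R <= m%:R / d%:R :> R.
Proof.
have [->|d_gt0] := posnP d; first by rewrite divn0 invr0 mulr0.
by rewrite ler_pdivlMr ?ltr0n // -natrM ler_nat leq_divM.
Qed.

Lemma trunc_log_le_ln (R : realType) (b m : nat) (x : R) :
  (1 < b)%N -> (0 < m)%N -> m%:R <= x ->
  (trunc_log b m)%:R <= ln x / ln b%:R.
Proof.
move=> b_gt1 m_gt0 le_mx.
rewrite ler_pdivlMr ?ln_gt0 ?ltr1n // mulr_natl -lnXn ?ltr0n ?(ltnW b_gt1) //.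
rewrite ler_ln ?posrE ?exprn_gt0 ?ltr0n ?(ltnW b_gt1) //.
  by apply: le_trans le_mx; rewrite -natrX ler_nat trunc_logP.
by apply: lt_le_trans le_mx; rewrite ltr0n.
Qed.

Lemma log2_ge1_ge1 (R : realType) (x : R) : 1 <= log2_ge1 x.
Proof. by rewrite le_max lexx. Qed.

Lemma trunc_log_le_log2_ge1 (R : realType) (m : nat) (x : R) :
  m%:R <= x -> (trunc_log 2 m)%:R <= log2_ge1 x.
Proof.
have [->|m_gt0] := posnP m; first by rewrite trunc_log0 le_max ler01.
by move=> le_mx; rewrite le_max trunc_log_le_ln ?orbT.
Qed.

Theorem theorem3p12 (R : realType) :
  exists2 C : R, 0 < C &
    forall (A : eqType) (n : nat) (T : n.-tuple A) (Gamma : {set 'I_n}),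
      string_attractor T Gamma ->
      exists2 D : seq (directive A n), bidirectional_parse T D &
        (size D)%:R <= C * (#|Gamma|%:R * log2_ge1 (n%:R / #|Gamma|%:R)).
Proof.
exists 7%:R => [|A n T Gamma attT]; first by rewrite ltr0n.
have [D parseD sizeD] := attractor_parse_trunc_log attT.
exists D => //.
have := trunc_log_le_log2_ge1 (natr_divn_le R n #|Gamma|).
have := log2_ge1_ge1 (n%:R / #|Gamma|%:R : R).
set L := log2_ge1 _; set t := trunc_log _ _ in sizeD * => L_ge1 le_tL.
apply: (@le_trans _ _ (#|Gamma| * (2 * t + 5))%:R); first by rewrite ler_nat.
by rewrite natrM mulrCA ler_wpM2l ?ler0n // natrD natrM; lra.
Qed.
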